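(* The following conditions are equivalent for every semigroup $(\mathcal{H}, * )$: (i) There are a nonempty set $X$ and a discrete pseudometric $d \colon X^{2} \to \mathbb{R}$ such that $(\mathcal{H}, * )$ is isomorphic to $\mathcal{B}_X (P_{d^{-1}})$. (ii) Exactly one of the following three conditions holds: (a) $(\mathcal{H}, * )$ is a trivial group. (b) $(\mathcal{H}, * )$ is a group of order $2$. (c) $(\mathcal{H}, * )$ is obtained by adjunction of an identity element to a null semigroup of order $2$.
   Context: A pseudometric on $X$ is a function $d\colon X^2\to\mathbb{R}$ that is nonnegative, symmetric, satisfies $d(x,x)=0$ for all $x\in X$, and satisfies the triangle inequality. It is discrete if $|d(X^2)|\leqslant 2$. $\mathcal{B}_X$ is the semigroup of all binary relations on $X$ (subsets of $X^2$) under composition: $\langle x,y\rangle\in\psi\circ\gamma$ iff there is $z\in X$ with $\langle x,z\rangle\in\psi$ and $\langle z,y\rangle\in\gamma$. For nonempty $A\subseteq\mathcal{B}_X$, $\mathcal{B}_X(A)$ is the subsemigroup generated by $A$ (all finite compositions of one or more elements of $A$). $P_{d^{-1}}:=\{d^{-1}(r):r\in d(X^2)\}$ is the set of fibers of $d$. A trivial group is a group with a single element. A null semigroup is a semigroup with a zero element $\theta$ (i.e. $\theta*s=s*\theta=\theta$ for all $s$) in which every product of two elements equals $\theta$. The semigroup obtained from a semigroup $\mathcal{S}$ without identity element by adjunction of an identity element is $\mathcal{S}\cup\{e\}$, $e\notin\mathcal{S}$, with the multiplication extended by $e*e=e$ and $e*x=x*e=x$ for $x\in\mathcal{S}$. 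*)

(* Defs.v *)
From HB Require Import structures.
From mathcomp Require Import all_boot all_order all_algebra.
From mathcomp Require Import boolp classical_sets functions cardinality reals.

Set Implicit Arguments.
Unset Strict Implicit.
Unset Printing Implicit Defensive.

Local Open Scope classical_set_scope.
Local Open Scope group_scope.

Definition isomorphic (G H : semigroupType) : Prop :=
  exists f : {multiplicative G -> H}, bijective f.

Definition binrel (X : Type) : Type := set (X * X).

Section BinrelSemigroup.
Variable X : Type.

HB.instance Definition _ := gen_eqMixin (binrel X).
HB.instance Definition _ := gen_choiceMixin (binrel X).

(* The left factor is applied first; in [relation_scope], where composition is
   written the other way round, this is [gamma \; psi]. *)
Definition binrel_comp (psi gamma : binrel X) : binrel X :=
  [set xy | exists2 z, psi (xy.1, z) & gamma (z, xy.2)].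

Fact binrel_compA : associative binrel_comp.
Proof.
move=> p q r; apply/funext => -[x y]; apply/propext; split => /=.
- by move=> [z pxz [t /= qzt rty]]; exists t => //; exists z.
- by move=> [t [z /= pxz qzt] rty]; exists z => //; exists t.
Qed.

HB.instance Definition _ := isSemigroup.Build (binrel X) binrel_compA.

End BinrelSemigroup.

Inductive generated (S : semigroupType) (A : set S) : S -> Prop :=
| Generator x of A x : generated A x
| GeneratedMul x y of generated A x & generated A y : generated A (x * y).

Section GeneratedSubsemigroup.
Variables (S : semigroupType) (A : set S).

Definition in_generated : {pred S} := fun x => `[< generated A x >].

Fact in_generated_mulg_closed : mulg_closed in_generated.
Proof.
by move=> x y /asboolP Ax /asboolP Ay; apply/asboolP; apply: GeneratedMul.
Qed.

Definition subsemigroup : Type := {x : S | x \in in_generated}.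

HB.instance Definition _ := Choice.on subsemigroup.
HB.instance Definition _ := SubType.on subsemigroup.
HB.instance Definition _ :=
  SubChoice_isSubSemigroup.Build S in_generated subsemigroup
    in_generated_mulg_closed.

End GeneratedSubsemigroup.

(* [None] is the adjoined identity. *)
Definition adjoin_id (S : Type) : Type := option S.

Section AdjoinId.
Variable S : semigroupType.

HB.instance Definition _ := Choice.on (adjoin_id S).

Definition adjoin_id_mul (x y : adjoin_id S) : adjoin_id S :=
  match x, y with
  | None, _ => y
  | _, None => x
  | Some s, Some t => Some (s * t)
  end.

Fact adjoin_id_mulA : associative adjoin_id_mul.
Proof. by move=> [x|] [y|] [z|] //=; rewrite mulgA. Qed.

HB.instance Definition _ := isSemigroup.Build (adjoin_id S) adjoin_id_mulA.

End AdjoinId.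

Definition has_order (T : Type) (n : nat) : Prop := ([set: T] #= `I_n)%card.

Definition has_identity (S : semigroupType) : Prop :=
  exists e : S, left_id e *%g /\ right_id e *%g.

Definition null_semigroup (S : semigroupType) : Prop :=
  exists theta : S,
    (forall s : S, theta * s = theta /\ s * theta = theta) /\
    (forall s t : S, s * t = theta).

(* Any group structure on [H] inducing its product gives such a [G], and
   conversely one can be transported back along the isomorphism. *)
Definition group_of_order (n : nat) (H : semigroupType) : Prop :=
  exists G : groupType, has_order G n /\ isomorphic H G.

Definition trivial_group : semigroupType -> Prop := group_of_order 1.

Definition null2_with_identity (H : semigroupType) : Prop :=
  exists S : semigroupType,
    [/\ null_semigroup S, has_order S 2, ~ has_identity S
      & isomorphic H (adjoin_id S)].

Definition exactly_one_of_three (P Q S : Prop) : Prop :=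
  [\/ [/\ P, ~ Q & ~ S], [/\ ~ P, Q & ~ S] | [/\ ~ P, ~ Q & S]].

Section Pseudometrics.
Variables (R : realType) (X : Type).
Implicit Type d : X * X -> R.
Local Open Scope ring_scope.

Definition pseudometric d : Prop :=
  [/\ forall x y, 0 <= d (x, y),
      forall x y, d (x, y) = d (y, x),
      forall x, d (x, x) = 0
    & forall x y z, d (x, y) <= d (x, z) + d (z, y)].

Definition discrete d : Prop := (range d #<= `I_2)%card.

Definition fibers d : set (binrel X) :=
  [set d @^-1` [set r] | r in range d].

End Pseudometrics.

(* Main.v *)
(**
Let E be the zero fibre of a discrete pseudometric: an equivalence relation.
If the distance vanishes, E is the only fibre; otherwise the fibres are E and
its complement N, and E is neutral for composition. With two classes N * N = E,
and with three or more classes N * N is the full relation, which absorbs both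
N and itself. Hence the generated semigroup is 'I_1, 'I_2 or a two-element null
semigroup with an identity adjoined, and the 0-1 metrics on 'I_1, 'I_2 and 'I_3
realise these three cases, which are distinguished by their orders.
*)
Require Import Defs.
From HB Require Import structures.
From mathcomp Require Import all_boot all_order all_algebra.
From mathcomp Require Import boolp classical_sets functions cardinality reals.

Set Implicit Arguments.
Unset Strict Implicit.
Unset Printing Implicit Defensive.

Local Open Scope classical_set_scope.

(** * Isomorphisms of semigroups and of generated subsemigroups *)

Lemma isomorphicI (G H : semigroupType) (f : G -> H) :
  {morph f : x y / (x * y)%g} -> bijective f -> isomorphic G H.
Proof.
move=> fM bij_f.
pose g : {multiplicative G -> H} := HB.pack f (isMultiplicative.Build G H f fM).
by exists g.
Qed.

Lemma isomorphic_sym (G H : semigroupType) : isomorphic G H -> isomorphic H G.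
Proof.
move=> [f [g fK gK]]; apply: (@isomorphicI _ _ g); last by exists f.
by move=> x y; apply: (can_inj fK); rewrite gmulfM !gK.
Qed.

Lemma isomorphic_trans (G H K : semigroupType) :
  isomorphic G H -> isomorphic H K -> isomorphic G K.
Proof.
move=> [f bij_f] [g bij_g]; apply: (@isomorphicI _ _ (g \o f)).
  by move=> x y /=; rewrite !gmulfM.
exact: bij_comp.
Qed.

(** The range of [f] is closed under products, so once it contains the generators it contains all of
    [generated A]. The other inclusion lets [f] corestrict to the subsemigroup. *)
Lemma subsemigroup_isomorphic (K S : semigroupType) (A : set S) (f : K -> S) :
  {morph f : x y / (x * y)%g} -> injective f ->
  A `<=` range f -> range f `<=` generated A ->
  isomorphic (subsemigroup A) K.
Proof.
move=> fM f_inj Af fA; apply: isomorphic_sym.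
have fP x : f x \in in_generated A by apply/asboolP; apply: fA; exists x.
pose g x : subsemigroup A := Sub (f x) (fP x).
have gE x : val (g x) = f x by rewrite SubK.
have g_surj u : exists x, g x = u.
  have /asboolP : val u \in in_generated A := valP u.
  (* Passing from [u] to an arbitrary element of [S] makes induction on [generated] possible. *)
  suff gen_f s : generated A s -> exists x, f x = s.
    by move=> /gen_f[x fx]; exists x; apply: val_inj; rewrite gE.
  elim=> [{}s /Af[x _ <-]|_ _ _ [x <-] _ [y <-]]; first by exists x.
  by exists (x * y)%g; rewrite fM.
have [h hK] := choice g_surj.
have g_inj : injective g by move=> x y /(congr1 val); rewrite !gE => /f_inj.
apply: (@isomorphicI _ _ g); last by exists h => // x; apply: g_inj.
by move=> x y; apply: val_inj; rewrite gmulfM !gE fM.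
Qed.

(** * Finite orders and the three model semigroups *)

Lemma has_order_bij (T : Type) (n : nat) :
  has_order T n.+1 <-> exists f : T -> 'I_n.+1, bijective f.
Proof.
have -> : has_order T n.+1 = ([set: T] #= [set: 'I_n.+1])%card.
  by rewrite /has_order (card_eqr card_II).
(* [card_set_bijP] is applied with a pointed codomain, hence the successor in the order. *)
pose P : pointedType := HB.pack 'I_n.+1 (isPointed.Build 'I_n.+1 ord0).
split=> [/(@card_set_bijP _ P)[f]|[f]].
  by rewrite setTT_bijective; exists f.
by rewrite -setTT_bijective => bij_f; apply/(@card_set_bijP _ P); exists f.
Qed.

Lemma has_order1 (T : Type) (x : T) : has_order T 1 -> forall y, y = x.
Proof.
by move=> /has_order_bij[f /bij_inj f_inj] y; apply: f_inj; rewrite !ord1.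
Qed.

Lemma has_order2 (T : Type) (x : T) : has_order T 2 ->
  exists2 y, x <> y & forall z, z = x \/ z = y.
Proof.
move=> /has_order_bij[f [g fK gK]].
have ord2 (i j k : 'I_2) : i != j -> (k == i) || (k == j).
  by case: i j k => [[|[|i]]] // ? [[|[|j]]] // ? [[|[|k]]].
pose j : 'I_2 := if f x == ord0 then ord_max else ord0.
have fxj : f x != j by rewrite /j; case: ifPn => // /eqP->.
exists (g j) => [xE|z]; first by rewrite xE gK eqxx in fxj.
by have /orP[] := ord2 _ _ (f z) fxj => /eqP fz; [left|right];
  rewrite -(fK z) fz ?fK.
Qed.

(** The group product on ['I_1], and on ['I_2] below, is addition of residues, with [ord0]
    neutral. *)
Lemma trivial_group_isomorphic (H : semigroupType) :
  trivial_group H <-> isomorphic H 'I_1.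
Proof.
split=> [[G [G1 HG]]|H1]; last first.
  by exists 'I_1; split=> //; apply/has_order_bij; exists id; exists id.
apply: isomorphic_trans HG _; apply: (@isomorphicI _ _ (fun=> ord0)).
  by move=> x y; apply: val_inj.
by exists (fun=> 1%g) => [x|i]; rewrite ?ord1 //; apply/esym/has_order1.
Qed.

Lemma group_of_order2_isomorphic (H : semigroupType) :
  group_of_order 2 H <-> isomorphic H 'I_2.
Proof.
split=> [[G [G2 HG]]|H2]; last first.
  by exists 'I_2; split=> //; apply/has_order_bij; exists id; exists id.
apply: isomorphic_trans HG _; apply: isomorphic_sym.
have [a a1 aG] := has_order2 1%g G2.
(* Otherwise [a * a = a], and cancelling [a] gives [a = 1]. *)
have aa : (a * a = 1)%g.
  case: (aG (a * a)%g) => // /(congr1 (fun x => a^-1 * x)%g).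
  by rewrite mulKg mulVg => /esym.
pose f (i : 'I_2) : G := if i == ord0 then 1%g else a.
have fM : {morph f : x y / (x * y)%g}.
  by case=> [[|[|//]] ?] [[|[|//]] ?]; rewrite /f /= ?mul1g ?mulg1 ?aa.
apply: (@isomorphicI _ _ f) => //.
pose g (x : G) : 'I_2 := if x == 1%g then ord0 else ord_max.
have a1F : (a == 1%g) = false by apply/eqP => /esym.
exists g => [i|x]; rewrite /f /g; last by case: (aG x) => ->; rewrite ?eqxx ?a1F.
by case: i => [[|[|//]] ?]; rewrite /= ?eqxx ?a1F; apply: val_inj.
Qed.

(** The model of a null semigroup of order 2, with zero [false]; a separate name keeps its product
    off [bool] itself. *)
Definition null2 : Type := bool.

HB.instance Definition _ := Choice.on null2.

Definition null2_mul (x y : null2) : null2 := false.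

Fact null2_mulA : associative null2_mul.
Proof. by []. Qed.

HB.instance Definition _ := isSemigroup.Build null2 null2_mulA.

Lemma null2_with_identity_isomorphic (H : semigroupType) :
  null2_with_identity H <-> isomorphic H (adjoin_id null2).
Proof.
split=> [[S [[t [_ St]] S2 _ HS]]|H3]; last first.
  exists null2; split=> //; first by exists false.
  - apply/has_order_bij; exists (fun x : bool => if x then ord_max else ord0).
    exists (fun i => i == ord_max) => [[]//|[[|[|//]] ?]];
      by apply: val_inj.
  (* An identity would fix [true], but every product is [false]. *)
  - by move=> [e [/(_ true)]].
apply: isomorphic_trans HS _; apply: isomorphic_sym.
have [s ts Sts] := has_order2 t S2.
pose f (x : adjoin_id null2) : adjoin_id S :=
  if x is Some b then Some (if b : bool then s else t) else None.
apply: (@isomorphicI _ _ f).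
  by move=> [x|] [y|] //; congr Some; rewrite /= St.
have stF : (t == s) = false by apply/eqP.
exists (fun x => if x is Some u then Some (u == s) else None).
  by case=> [[]|] //=; rewrite ?eqxx ?stF.
by case=> [u|] //=; case: (Sts u) => ->; rewrite ?eqxx ?stF.
Qed.

(** Tells the models apart by their orders. [I] and [J] do the counting, since [K] and [L] may lack
    a finite structure, as [adjoin_id null2] does. *)
Lemma isomorphic_card (H K L : semigroupType) (I J : finType)
    (f : I -> K) (g : L -> J) :
  bijective f -> bijective g ->
  isomorphic H K -> isomorphic H L -> #|I| = #|J|.
Proof.
move=> bij_f bij_g /isomorphic_sym HK HL.
have [h bij_h] := isomorphic_trans HK HL.
exact: bij_eq_card (bij_comp bij_g (bij_comp bij_h bij_f)).
Qed.

(** The models have 1, 2 and 3 elements, so the conditions exclude one another and a plain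
    disjunction suffices. *)
Lemma exactly_one_of_threeE (H : semigroupType) :
  exactly_one_of_three
    (trivial_group H) (group_of_order 2 H) (null2_with_identity H) <->
  [\/ isomorphic H 'I_1, isomorphic H 'I_2 | isomorphic H (adjoin_id null2)].
Proof.
rewrite /exactly_one_of_three.
rewrite (propext (trivial_group_isomorphic H)).
rewrite (propext (group_of_order2_isomorphic H)).
rewrite (propext (null2_with_identity_isomorphic H)).
have bij_idT (T : Type) : bijective (@id T) by exists id.
have n12 : isomorphic H 'I_1 -> ~ isomorphic H 'I_2.
  move=> H1 H2.
  have := @isomorphic_card H 'I_1 'I_2 'I_1 'I_2 id id (bij_idT _) (bij_idT _) H1 H2.
  by rewrite !card_ord.
have n13 : isomorphic H 'I_1 -> ~ isomorphic H (adjoin_id null2).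
  move=> H1 H3.
  have := @isomorphic_card H 'I_1 (adjoin_id null2) 'I_1 (option bool)
    id id (bij_idT _) (bij_idT _) H1 H3.
  by rewrite card_ord card_option card_bool.
have n23 : isomorphic H 'I_2 -> ~ isomorphic H (adjoin_id null2).
  move=> H2 H3.
  have := @isomorphic_card H 'I_2 (adjoin_id null2) 'I_2 (option bool)
    id id (bij_idT _) (bij_idT _) H2 H3.
  by rewrite card_ord card_option card_bool.
split=> [[[H1 _ _]|[_ H2 _]|[_ _ H3]]|[H1|H2|H3]].
- exact: Or31.
- exact: Or32.
- exact: Or33.
- by apply: Or31; split=> //; [apply: n12|apply: n13].
- by apply: Or32; split=> // [/n12|]; [apply|apply: n23].
- by apply: Or33; split=> // [/n13|/n23]; apply.
Qed.

(** * Composition of an equivalence relation with its complement *)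

Section EquivalenceAndComplement.
Variables (X : Type) (E : binrel X).
Hypotheses (E_refl : forall x, E (x, x))
  (E_sym : forall x y, E (x, y) -> E (y, x))
  (E_trans : forall x y z, E (x, y) -> E (y, z) -> E (x, z)).

Let N : binrel X := ~` E.
Let T : binrel X := setT.

Definition three_classes := exists a b c, [/\ N (a, b), N (a, c) & N (b, c)].

Lemma binrel_mulE (p q : binrel X) x y :
  (p * q)%g (x, y) = exists2 z, p (x, z) & q (z, y).
Proof. by []. Qed.

Lemma binrelP (p q : binrel X) :
  (forall x y, p (x, y) <-> q (x, y)) -> p = q.
Proof. by move=> pq; apply/funext => -[x y]; apply/propext. Qed.

Lemma equiv_mul : (E * E = E)%g.
Proof.
apply: binrelP => x y; rewrite binrel_mulE; split=> [[z]|]; last by exists x.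
exact: E_trans.
Qed.

Lemma equiv_mul_compl : (E * N = N)%g.
Proof.
apply: binrelP => x y; rewrite binrel_mulE; split=> [[z xz zy xy]|]; last by exists x.
by apply: zy; apply: E_trans xy; apply: E_sym.
Qed.

Lemma compl_mul_equiv : (N * E = N)%g.
Proof.
apply: binrelP => x y; rewrite binrel_mulE; split=> [[z xz zy xy]|]; last by exists y.
by apply: xz; apply: E_trans xy _; apply: E_sym.
Qed.

Lemma equiv_mulT : (E * T = T)%g.
Proof. by apply: binrelP => x y; rewrite binrel_mulE; split=> // _; exists x. Qed.

Lemma mulT_equiv : (T * E = T)%g.
Proof. by apply: binrelP => x y; rewrite binrel_mulE; split=> // _; exists y. Qed.

Lemma compl_sym x y : N (x, y) -> N (y, x).
Proof. by move=> xy /E_sym. Qed.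

(** No point is equivalent to both members of an inequivalent pair. *)
Lemma compl_serial : N !=set0 -> forall x, exists y, N (x, y).
Proof.
move=> [[a b] ab] x; have [xa|] := EM (E (x, a)); last by exists a.
by exists b => xb; apply: ab; apply: E_trans xb; apply: E_sym.
Qed.

Lemma compl_mulT : N !=set0 -> (N * T = T)%g.
Proof.
move=> /compl_serial N_serial; apply: binrelP => x y; split=> // _.
by have [z xz] := N_serial x; exists z.
Qed.

Lemma mulT_compl : N !=set0 -> (T * N = T)%g.
Proof.
move=> /compl_serial N_serial; apply: binrelP => x y; split=> // _.
by have [z /compl_sym yz] := N_serial y; exists z.
Qed.

(** If [x] and [y] both differ in class from [z], they share a class, for want of a third one.
    Conversely, any point outside the class of [x] links [x] to each of its equivalents. *)
Lemma compl_mul2 : N !=set0 -> ~ three_classes -> (N * N = E)%g.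
Proof.
move=> /compl_serial N_serial N3; apply: binrelP => x y; split=> [[z /= xz zy]|xy].
  by apply: contrapT => xy; apply: N3; exists x, z, y.
have [z xz] := N_serial x; exists z => //= /E_sym yz.
by apply: xz; apply: E_trans yz.
Qed.

(** A link from [x] to [y] is a point outside both of their classes, and two classes cannot cover
    three. *)
Lemma compl_mul3 : three_classes -> (N * N = T)%g.
Proof.
move=> [a [b [c [ab ac bc]]]]; apply: binrelP => x y; split=> // _.
apply: contrapT => Nxy.
have xyP z : E (x, z) \/ E (z, y).
  apply: contrapT => /not_orP[xz zy]; apply: Nxy; by exists z.
have Ex u v : N (u, v) -> E (x, u) -> ~ E (x, v).
  by move=> uv /E_sym ux xv; apply: uv; apply: E_trans xv.
have Ey u v : N (u, v) -> E (u, y) -> ~ E (v, y).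
  by move=> uv uy /E_sym yv; apply: uv; apply: E_trans yv.
(* Pigeonhole: two of [a], [b], [c] fall into the same one of the two classes. *)
case: (xyP a) => [xa|ay]; case: (xyP b) => [xb|yb]; case: (xyP c) => [xc|cy].
all: by [apply: (Ex a b ab)|apply: (Ex a c ac)|apply: (Ex b c bc)
        |apply: (Ey a b ab)|apply: (Ey a c ac)|apply: (Ey b c bc)].
Qed.

Lemma equiv_neq_compl : N !=set0 -> E <> N.
Proof. by move=> [[a b] ab] EN; have := E_refl a; rewrite EN; apply. Qed.

Lemma equiv_neqT : N !=set0 -> E <> T.
Proof. by move=> [[a b] ab] ET; apply: ab; rewrite ET. Qed.

Lemma compl_neqT : N !=set0 -> N <> T.
Proof.
by move=> [[a b] _] NT; have: N (a, a); [rewrite NT|apply].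
Qed.

Lemma generated_equiv : isomorphic (subsemigroup [set E]) 'I_1.
Proof.
apply: (@subsemigroup_isomorphic 'I_1 _ _ (fun=> E)).
- by move=> i j; rewrite equiv_mul.
- by move=> i j _; rewrite !ord1.
- by move=> _ ->; exists ord0.
- by move=> _ [i _ <-]; apply: Generator.
Qed.

Lemma generated_equiv_compl2 : N !=set0 -> ~ three_classes ->
  isomorphic (subsemigroup [set E; N]) 'I_2.
Proof.
move=> N0 N3; have EN := equiv_neq_compl N0.
apply: (@subsemigroup_isomorphic 'I_2 _ _ (fun i => if i == ord0 then E else N)).
- by case=> [[|[|//]] ?] [[|[|//]] ?] /=;
    rewrite ?equiv_mul ?equiv_mul_compl ?compl_mul_equiv ?compl_mul2.
- by case=> [[|[|//]] ?] [[|[|//]] ?] //= EN'; apply: val_inj => //=;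
    case: EN; rewrite EN'.
- by move=> _ [->|->]; [exists ord0|exists ord_max].
- by move=> _ [i _ <-]; apply: Generator; case: ifP; [left|right].
Qed.

(** [T] is the zero of the null part and [N] its other element. The full relation is no generator
    here; it enters as [N * N]. *)
Lemma generated_equiv_compl3 : three_classes ->
  isomorphic (subsemigroup [set E; N]) (adjoin_id null2).
Proof.
move=> N3; have N0 : N !=set0 by have [a [b [c [ab _ _]]]] := N3; exists (a, b).
have EN := equiv_neq_compl N0; have ET := equiv_neqT N0; have NT := compl_neqT N0.
pose f (x : adjoin_id null2) : binrel X :=
  if x is Some b then if b : bool then N else T else E.
have genN : generated [set E; N] N by apply: Generator; right.
apply: (@subsemigroup_isomorphic _ _ _ f).
- have TT : (T * T = T)%g.
    by apply: binrelP => x y; split=> // _; exists x.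
  by case=> [[]|] [[]|] /=; rewrite ?equiv_mul ?equiv_mul_compl ?compl_mul_equiv
    ?(compl_mul3 N3) ?(compl_mulT N0) ?(mulT_compl N0) ?equiv_mulT ?mulT_equiv ?TT.
- by case=> [[]|] [[]|] //= fxy; congruence.
- by move=> _ [->|->]; [exists None|exists (Some true)].
- move=> _ [[[]|] _ <-] //=; last by apply: Generator; left.
  by rewrite -(compl_mul3 N3); apply: GeneratedMul.
Qed.

End EquivalenceAndComplement.

(** * The fibres of a discrete pseudometric *)

Section DiscretePseudometric.
Variables (R : realType) (X : Type) (d : X * X -> R).
Hypothesis d_pm : pseudometric d.
Local Open Scope ring_scope.
Import Order.TTheory GRing.Theory Num.Theory.

Let E : binrel X := d @^-1` [set 0].

Lemma zero_fiber_refl x : E (x, x).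
Proof. by have [_ _ d0 _] := d_pm; apply: d0. Qed.

Lemma zero_fiber_sym x y : E (x, y) -> E (y, x).
Proof. by have [_ dC _ _] := d_pm; rewrite /E /= dC. Qed.

Lemma zero_fiber_trans x y z : E (x, y) -> E (y, z) -> E (x, z).
Proof.
have [d_ge0 _ _ d_tri] := d_pm; rewrite /E /= => xy yz.
by apply/le_anti; rewrite d_ge0 (le_trans (d_tri x z y)) // xy yz addr0.
Qed.

(** A point of [X] ensures that the value 0 is attained, so that the range is not empty. *)
Lemma fibers_zero : [set: X] !=set0 -> ~ ((~` E) !=set0) -> fibers d = [set E].
Proof.
move=> [x _] NE; have d0 p : d p = 0 by apply: contrapT => dp; apply: NE; exists p.
rewrite /fibers; have -> : range d = [set 0]; last by rewrite image_set1.
by apply/seteqP; split=> [_ [p _ <-]|_ ->] //=; exists (x, x).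
Qed.

Lemma fibers_nonzero : discrete d -> (~` E) !=set0 -> fibers d = [set E; ~` E].
Proof.
move=> d2 [[a b] ab].
(* An injection of the range into two elements must identify two of the values [d p], 0 and
   [d (a, b)], and the last two differ. *)
have dP p : d p = 0 \/ d p = d (a, b).
  have /pcard_leP[f] := d2.
  have f2 q : (f (d q) < 2)%N by apply: (@funS _ _ _ _ f (d q)); exists q.
  have f_inj p' q : f (d p') = f (d q) -> d p' = d q.
    by apply: (@inj _ _ _ f); apply/mem_set; [exists p'|exists q].
  have [_ _ d0 _] := d_pm.
  have := f_inj p (a, a); have := f_inj p (a, b); have := f_inj (a, a) (a, b).
  have := f2 p; have := f2 (a, a); have := f2 (a, b); rewrite d0.
  case: (f (d p)) => [|[|]] //; case: (f 0) => [|[|]] //;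
    case: (f (d (a, b))) => [|[|]] // _ _ _ h1 h2 h3;
    by [left; apply: h3|right; apply: h2|case: ab; rewrite /E /= -h1].
have NE : ~` E = d @^-1` [set d (a, b)].
  apply/seteqP; split=> [p|p]; rewrite /E /=; first by case: (dP p).
  by move=> -> ab0; apply: ab.
rewrite NE /fibers; have -> : range d = [set 0; d (a, b)].
  apply/seteqP; split=> [_ [p _ <-]|_ [->|->]]; first exact: dP.
    by exists (a, a) => //; apply: zero_fiber_refl.
  by exists (a, b).
by rewrite image_setU !image_set1.
Qed.

(** The conditions on [E] beside the isomorphisms make it possible to decide which alternative a
    concrete metric falls under. *)
Lemma generated_fibers : [set: X] !=set0 -> discrete d ->
  [\/ isomorphic (subsemigroup (fibers d)) 'I_1 /\ ~ ((~` E) !=set0),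
      [/\ isomorphic (subsemigroup (fibers d)) 'I_2, (~` E) !=set0
        & ~ three_classes E]
    | isomorphic (subsemigroup (fibers d)) (adjoin_id null2) /\ three_classes E].
Proof.
move=> X0 d2; have [rE sE] := (zero_fiber_refl, zero_fiber_sym); have tE := zero_fiber_trans.
have [N0|N0] := EM ((~` E) !=set0); last first.
  by apply: Or31; split=> //; rewrite (fibers_zero X0 N0); apply: generated_equiv.
rewrite (fibers_nonzero d2 N0); have [N3|N3] := EM (three_classes E).
  by apply: Or33; split=> //; apply: generated_equiv_compl3.
by apply: Or32; split=> //; apply: generated_equiv_compl2.
Qed.

End DiscretePseudometric.

(** * The 0-1 metric on a finite set *)

Section ZeroOneMetric.
Variables (R : realType) (n : nat).
Local Open Scope ring_scope.
Import Order.TTheory GRing.Theory Num.Theory.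

Definition zero_one_dist (p : 'I_n.+1 * 'I_n.+1) : R := (p.1 != p.2)%:R.

Lemma zero_one_dist_pseudometric : pseudometric zero_one_dist.
Proof.
split=> [x y|x y|x|x y z]; rewrite /zero_one_dist /=.
- exact: ler0n.
- by rewrite eq_sym.
- by rewrite eqxx.
(* If [x = z] both sides agree; otherwise the first summand is already 1. *)
- rewrite -natrD ler_nat; have [->|xz] := eqVneq x z => //=.
  by case: (x != y).
Qed.

Lemma zero_one_dist_discrete : discrete zero_one_dist.
Proof.
have sub : range zero_one_dist `<=` (fun i => i%:R) @` `I_2.
  by move=> _ [p _ <-]; exists (p.1 != p.2) => //=; case: (_ != _).
exact: card_le_trans (subset_card_le sub) (card_image_le _ _).
Qed.

Lemma zero_one_distE x y : (~` (zero_one_dist @^-1` [set 0])) (x, y) <-> x <> y.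
Proof.
rewrite /zero_one_dist /=; split=> [xy xyE|xy].
  by apply: xy; rewrite xyE eqxx.
by have /eqP/negPf-> := xy; move=> /eqP; rewrite oner_eq0.
Qed.

End ZeroOneMetric.

(** * Classification and realisation *)

Theorem proposition4p25 (R : realType) (H : semigroupType) :
  (exists (X : Type) (d : X * X -> R),
      [/\ [set: X] !=set0, pseudometric d, discrete d
        & isomorphic H (subsemigroup (fibers d))])
  <->
  exactly_one_of_three
    (trivial_group H)
    (group_of_order 2 H)
    (null2_with_identity H).
Proof.
rewrite exactly_one_of_threeE; split=> [[X [d [X0 d_pm d2 Hd]]]|].
  case: (generated_fibers d_pm X0 d2) => [[dI _]|[dI _ _]|[dI _]].
  - exact: Or31 (isomorphic_trans Hd dI).
  - exact: Or32 (isomorphic_trans Hd dI).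
  - exact: Or33 (isomorphic_trans Hd dI).
pose N n : binrel 'I_n.+1 := ~` (@zero_one_dist R n @^-1` [set 0%R]).
have I0 n : [set: 'I_n.+1] !=set0 by exists ord0.
(* The index [n] stands for [n.+1] points, so 0, 1 and 2 below give one, two and three singleton
   classes. *)
have realised n K : isomorphic H K ->
    isomorphic (subsemigroup (fibers (@zero_one_dist R n))) K ->
    exists (X : Type) (d : X * X -> R),
      [/\ [set: X] !=set0, pseudometric d, discrete d
        & isomorphic H (subsemigroup (fibers d))].
  move=> HK /isomorphic_sym dK; exists 'I_n.+1, (@zero_one_dist R n); split=> //.
  - exact: zero_one_dist_pseudometric.
  - exact: zero_one_dist_discrete.
  - exact: isomorphic_trans HK dK.
have cases n := generated_fibers (zero_one_dist_pseudometric R n) (I0 n)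
  (zero_one_dist_discrete R n).
case=> HK.
(* On one point no distance is nonzero, which leaves only the first alternative. *)
- apply: (realised 0%N _ HK); have NF x y : ~ N 0%N (x, y) by move/zero_one_distE; rewrite !ord1.
  case: (cases 0%N) => [[]//|[_ [[x y] /NF//]]|[_ [x [y [_ [/NF//]]]]]].
(* On two points some distance is nonzero, but three points cannot be pairwise distinct. *)
- apply: (realised 1%N _ HK); case: (cases 1%N) => [[_ N0]|[]//|[_ [x [y [z []]]]]].
    by case: N0; exists (ord0, ord_max); apply/zero_one_distE.
  move=> /zero_one_distE xy /zero_one_distE xz /zero_one_distE yz.
  by case: x y z xy xz yz => [[|[|//]] ?] [[|[|//]] ?] [[|[|//]] ?] xy xz yz;
    first [case: xy; exact: val_inj|case: xz; exact: val_inj|case: yz; exact: val_inj].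
(* The points 0, 1 and 2 are pairwise distinct, which excludes the first two alternatives. *)
- have N3 : three_classes (@zero_one_dist R 2 @^-1` [set 0%R]).
    by exists ord0, (inord 1), ord_max; split; apply/zero_one_distE => /(congr1 val);
      rewrite /= ?inordK.
  apply: (realised 2%N _ HK); case: (cases 2%N) => [[_ N0]|[_ _]//|[]//].
  by case: N0; have [x [y [_ [xy _ _]]]] := N3; exists (x, y).
Qed.
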